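(* Let $R$ be a Noetherian domain containing $\mathbb{Q}$, let $B$ be an $\mathbb{A}^2$-fibration over $R$, and let $D$ be a non-zero locally nilpotent $R$-derivation of $B$. Then $\operatorname{grade}(D(B)B,B)\in\{1,2,\infty\}$.
   Context: All rings are commutative with unity. An $R$-algebra $B$ is an $\mathbb{A}^n$-fibration over $R$ if $B$ is finitely generated as an $R$-algebra, flat as an $R$-module, and for each $\mathfrak{p}\in\operatorname{Spec}(R)$, $B\otimes_R k(\mathfrak{p})$ is isomorphic as a $k(\mathfrak p)$-algebra to a polynomial ring in $n$ variables over $k(\mathfrak{p})=R_{\mathfrak p}/\mathfrak pR_{\mathfrak p}$. An $R$-derivation $D:B\to B$ is an $R$-linear map satisfying the Leibniz rule; it is locally nilpotent if for each $b\in B$ there is $n\ge 0$ with $D^n(b)=0$. $D(B)B$ is the ideal of $B$ generated by the image of $D$. For an ideal $I$ of a Noetherian ring $S$, $\operatorname{grade}(I,S)$ is the length of a maximal $S$-regular sequence contained in $I$ if $I\ne S$, and is $\infty$ if $I=S$. *)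

(* Defs.v *)
From HB Require Import structures.
(* mpoly must be imported before the mathcomp-analysis files: in the other
   order their notations clash. *)
From mathcomp Require Import all_boot all_order all_algebra.
From mathcomp Require Import mpoly generic_quotient ring_quotient.
From mathcomp Require Import ring.
From mathcomp Require Import boolp classical_sets constructive_ereal.

Set Implicit Arguments.
Unset Strict Implicit.
Unset Printing Implicit Defensive.

Import GRing.Theory.

Local Open Scope ring_scope.
Local Open Scope quotient_scope.
Local Open Scope classical_set_scope.

(* Unlike [idealr_closed] of ring_quotient, the unit ideal is allowed. *)
Definition is_ideal (S : comNzRingType) (I : set S) : Prop :=
  [/\ I 0, (forall x y, I x -> I y -> I (x + y)) & forall a x, I x -> I (a * x)].

Definition ideal_gen (S : comNzRingType) (A : set S) : set S :=
  smallest (@is_ideal S) A.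

Definition noetherian (S : comNzRingType) : Prop :=
  forall I : set S, is_ideal I -> exists s : seq S, I = ideal_gen [set` s].

(* The i-th term is a nonzerodivisor on S / (s_0, ..., s_(i-1)), and
   S / (s_0, ..., s_(n-1)) is nonzero. *)
Definition regular_seq (S : comNzRingType) (s : seq S) : Prop :=
  (forall i : nat, (i < size s)%N -> forall b : S,
     ideal_gen [set` take i s] (s`_i * b) -> ideal_gen [set` take i s] b) /\
  ideal_gen [set` s] <> setT.

Definition maximal_regular_seq_in (S : comNzRingType) (I : set S) (s : seq S) :
    Prop :=
  [/\ regular_seq s, [set` s] `<=` I &
      forall a : S, I a -> ~ regular_seq (rcons s a)].

(* For S Noetherian and I a proper ideal, maximal regular sequences in I exist
   and all have the same length, so neither the choice made by [xget] nor its
   default value 0 matters. *)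
Definition grade (S : comNzRingType) (I : set S) : \bar nat :=
  if `[< I = setT >] then +oo%E
  else EFin (xget 0%N
    [set n | exists2 s : seq S, maximal_regular_seq_in I s & size s = n]).

Section Tensor.
Variables (R : comNzRingType) (M N : lmodType R).
Implicit Types (s t : seq (M * N)).

(* The sequence (x_1, y_1), ..., (x_k, y_k) encodes the sum of the
   x_i (x) y_i: the quotient below is the free commutative monoid on M * N
   modulo bilinearity; it is a group since (- x) (x) y is inverse to x (x) y. *)
Inductive tensor_rel : seq (M * N) -> seq (M * N) -> Prop :=
| tensor_rel_refl s : tensor_rel s s
| tensor_rel_sym s t : tensor_rel s t -> tensor_rel t s
| tensor_rel_trans s t u : tensor_rel s t -> tensor_rel t u -> tensor_rel s u
| tensor_rel_cat s s' t t' :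
    tensor_rel s s' -> tensor_rel t t' -> tensor_rel (s ++ t) (s' ++ t')
| tensor_rel_catC s t : tensor_rel (s ++ t) (t ++ s)
| tensor_rel0l y : tensor_rel [:: (0, y)] [::]
| tensor_relDl x x' y : tensor_rel [:: (x + x', y)] [:: (x, y); (x', y)]
| tensor_relDr x y y' : tensor_rel [:: (x, y + y')] [:: (x, y); (x, y')]
| tensor_relZ a x y : tensor_rel [:: (a *: x, y)] [:: (x, a *: y)].

Definition tensor_equiv s t : bool := `[< tensor_rel s t >].

Lemma tensor_equiv_class : equiv_class_of tensor_equiv.
Proof.
split=> [s|s t|t s u].
- exact/asboolP/tensor_rel_refl.
- by apply/idP/idP => /asboolP/tensor_rel_sym/asboolP.
- by move=> /asboolP st /asboolP tu; apply/asboolP; apply: tensor_rel_trans st tu.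
Qed.

Canonical tensor_equivRel := EquivRelPack tensor_equiv_class.
Canonical tensor_encModRel := defaultEncModRel tensor_equiv.

Definition tensor := {eq_quot tensor_equiv}.
HB.instance Definition _ : EqQuotient _ tensor_equiv tensor :=
  EqQuotient.on tensor.
HB.instance Definition _ := Choice.on tensor.

Lemma tensor_piP s t :
  tensor_rel s t <-> \pi_tensor s = \pi_tensor t.
Proof.
split=> [st|/eqmodP/asboolP//].
exact/eqmodP/asboolP.
Qed.

Definition pure_tensor (x : M) (y : N) : tensor := \pi_tensor [:: (x, y)].

Definition tensor0 : tensor := \pi_tensor [::].
Definition tensor_add (u v : tensor) : tensor := \pi_tensor (repr u ++ repr v).

Lemma tensor_rel_repr s : tensor_rel (repr (\pi_tensor s)) s.
Proof. by apply/tensor_piP; rewrite reprK. Qed.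

Lemma tensor_add_pi s t :
  tensor_add (\pi_tensor s) (\pi_tensor t) = \pi_tensor (s ++ t).
Proof. by apply/tensor_piP; apply: tensor_rel_cat; exact: tensor_rel_repr. Qed.

Lemma tensor_addA : associative tensor_add.
Proof.
elim/quotW=> s; elim/quotW=> t; elim/quotW=> u.
rewrite (tensor_add_pi t u) (tensor_add_pi s t).
by rewrite (tensor_add_pi s) tensor_add_pi catA.
Qed.

Lemma tensor_addC : commutative tensor_add.
Proof.
elim/quotW=> s; elim/quotW=> t; rewrite !tensor_add_pi.
exact/tensor_piP/tensor_rel_catC.
Qed.

Lemma tensor_add0 : left_id tensor0 tensor_add.
Proof. by elim/quotW=> s; rewrite tensor_add_pi. Qed.

HB.instance Definition _ :=
  GRing.isNmodule.Build tensor tensor_addA tensor_addC tensor_add0.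

Lemma tensor_pi_sum s : \pi_tensor s = \sum_(z <- s) pure_tensor z.1 z.2.
Proof.
elim: s => [|[x y] s IHs]; first by rewrite big_nil.
by rewrite big_cons -IHs -cat1s -tensor_add_pi.
Qed.

Lemma tensor_sum (u : tensor) : u = \sum_(z <- repr u) pure_tensor z.1 z.2.
Proof. by rewrite -tensor_pi_sum reprK. Qed.

Lemma pure_tensorDl x x' y :
  pure_tensor (x + x') y = pure_tensor x y + pure_tensor x' y.
Proof.
rewrite [RHS]tensor_add_pi; exact/tensor_piP/tensor_relDl.
Qed.

Lemma pure_tensorDr x y y' :
  pure_tensor x (y + y') = pure_tensor x y + pure_tensor x y'.
Proof.
rewrite [RHS]tensor_add_pi; exact/tensor_piP/tensor_relDr.
Qed.

Lemma pure_tensorZ a x y : pure_tensor (a *: x) y = pure_tensor x (a *: y).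
Proof. exact/tensor_piP/tensor_relZ. Qed.

Lemma pure_tensor0l y : pure_tensor 0 y = 0.
Proof. exact/tensor_piP/tensor_rel0l. Qed.

Lemma pure_tensor0r x : pure_tensor x 0 = 0.
Proof. by rewrite -(scale0r 0) -pure_tensorZ scale0r pure_tensor0l. Qed.

Definition tensor_opp (u : tensor) : tensor :=
  \sum_(z <- repr u) pure_tensor (- z.1) z.2.

Lemma tensor_addN : left_inverse 0 tensor_opp +%R.
Proof.
move=> u; rewrite [X in _ + X]tensor_sum /tensor_opp -big_split /=.
by rewrite big1// => z _; rewrite -pure_tensorDl addNr pure_tensor0l.
Qed.

HB.instance Definition _ := GRing.Nmodule_isZmodule.Build tensor tensor_addN.

Lemma tensor_ind (P : tensor -> Prop) :
  (forall x y, P (pure_tensor x y)) -> (forall u v, P u -> P v -> P (u + v)) ->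
  forall u, P u.
Proof.
move=> Ppure PD u; rewrite [u]tensor_sum; elim: (repr u) => [|z s IHs].
  by rewrite big_nil -(pure_tensor0l 0).
by rewrite big_cons; apply: PD.
Qed.

Definition balanced (Z : zmodType) (h : M -> N -> Z) : Prop :=
  [/\ forall x x' y, h (x + x') y = h x y + h x' y,
      forall x y y', h x (y + y') = h x y + h x y' &
      forall a x y, h (a *: x) y = h x (a *: y)].

Definition tensor_lift (Z : zmodType) (h : M -> N -> Z) (u : tensor) : Z :=
  \sum_(z <- repr u) h z.1 z.2.

Section Lift.
Variables (Z : zmodType) (h : M -> N -> Z) (hB : balanced h).

Lemma tensor_lift_pi s :
  tensor_lift h (\pi_tensor s) = \sum_(z <- s) h z.1 z.2.
Proof.
case: hB => hDl hDr hZ.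
suff rel_sum s1 s2 : tensor_rel s1 s2 ->
    \sum_(z <- s1) h z.1 z.2 = \sum_(z <- s2) h z.1 z.2.
  exact/rel_sum/tensor_rel_repr.
elim=> {s s1 s2} //=.
- by move=> s t u _ -> _ ->.
- by move=> s s' t t' _ IHs _ IHt; rewrite !big_cat IHs IHt.
- by move=> s t; rewrite !big_cat /= addrC.
- move=> y; rewrite big_seq1 big_nil /=; apply: (addrI (h 0 y)).
  by rewrite -hDl !addr0.
- by move=> x x' y; rewrite !big_cons !big_nil /= hDl !addr0.
- by move=> x y y'; rewrite !big_cons !big_nil /= hDr !addr0.
- by move=> a x y; rewrite !big_seq1 /= hZ.
Qed.

Lemma tensor_lift_pure x y : tensor_lift h (pure_tensor x y) = h x y.
Proof. by rewrite tensor_lift_pi big_seq1. Qed.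

Lemma tensor_liftD u v :
  tensor_lift h (u + v) = tensor_lift h u + tensor_lift h v.
Proof.
elim/quotW: u => s; elim/quotW: v => t.
rewrite [X in tensor_lift h X]tensor_add_pi.
by rewrite !tensor_lift_pi big_cat.
Qed.

End Lift.

End Tensor.

Section TensorMap.
Variables (R : comNzRingType) (M M' N N' : lmodType R).
Variables (f : {linear M -> M'}) (g : {linear N -> N'}).

Definition tensor_map : tensor M N -> tensor M' N' :=
  tensor_lift (fun x y => pure_tensor (f x) (g y)).

Lemma tensor_map_balanced : balanced (fun x y => pure_tensor (f x) (g y)).
Proof.
split=> [x x' y|x y y'|a x y].
- by rewrite linearD pure_tensorDl.
- by rewrite linearD pure_tensorDr.
- by rewrite !linearZ /= pure_tensorZ.
Qed.

Lemma tensor_map_pure x y :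
  tensor_map (pure_tensor x y) = pure_tensor (f x) (g y).
Proof. exact/tensor_lift_pure/tensor_map_balanced. Qed.

Lemma tensor_mapD u v : tensor_map (u + v) = tensor_map u + tensor_map v.
Proof. exact/tensor_liftD/tensor_map_balanced. Qed.

End TensorMap.

Definition flat (R : comNzRingType) (M : lmodType R) : Prop :=
  forall (N N' : lmodType R) (f : {linear N -> N'}),
    injective f -> injective (tensor_map (idfun : {linear M -> M}) f).

(* [tensor A C] under a new name, so that it can carry the C-module structure
   acting on the right factor. *)
Definition base_change (R : comNzRingType) (A C : comAlgType R) : Type :=
  tensor A C.

Section BaseChange.
Variables (R : comNzRingType) (A C : comAlgType R).
Local Notation T := (base_change A C).
HB.instance Definition _ := GRing.Zmodule.on T.
Implicit Types (u v w : T).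

Local Notation "x *t y" := (pure_tensor x y : T) (at level 35).

Definition bc_mull (x : A) (y : C) : T -> T :=
  tensor_lift (fun x' y' => (x * x') *t (y * y')).
Definition bc_mul u v : T := tensor_lift (fun x y => bc_mull x y v) u.
Definition bc_one : T := 1 *t 1.
Definition bc_scale (c : C) u : T := tensor_lift (fun x y => x *t (c * y)) u.

Lemma bc_mull_balanced x y :
  balanced (fun x' y' => (x * x') *t (y * y')).
Proof.
split=> [x1 x2 y'|x' y1 y2|a x' y'].
- by rewrite mulrDr pure_tensorDl.
- by rewrite mulrDr pure_tensorDr.
- by rewrite -!scalerAr pure_tensorZ.
Qed.

Lemma bc_mull_pure x y x' y' : bc_mull x y (x' *t y') = (x * x') *t (y * y').
Proof. exact/tensor_lift_pure/bc_mull_balanced. Qed.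

Lemma bc_mullD x y u v : bc_mull x y (u + v) = bc_mull x y u + bc_mull x y v.
Proof. exact/tensor_liftD/bc_mull_balanced. Qed.

Lemma bc_mul_balanced v : balanced (fun x y => bc_mull x y v).
Proof.
split=> [x x' y|x y y'|a x y].
- elim/(@tensor_ind R A C): v => [x1 y1|u1 u2 IH1 IH2].
    by rewrite !bc_mull_pure mulrDl pure_tensorDl.
  by rewrite !bc_mullD IH1 IH2 addrACA.
- elim/(@tensor_ind R A C): v => [x1 y1|u1 u2 IH1 IH2].
    by rewrite !bc_mull_pure mulrDl pure_tensorDr.
  by rewrite !bc_mullD IH1 IH2 addrACA.
- elim/(@tensor_ind R A C): v => [x1 y1|u1 u2 IH1 IH2].
    by rewrite !bc_mull_pure -!scalerAl pure_tensorZ.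
  by rewrite !bc_mullD IH1 IH2.
Qed.

Lemma bc_mul_pure x y x' y' : bc_mul (x *t y) (x' *t y') = (x * x') *t (y * y').
Proof.
by rewrite /bc_mul tensor_lift_pure ?bc_mull_pure//; exact: bc_mul_balanced.
Qed.

Lemma bc_mulDl : left_distributive bc_mul +%R.
Proof. by move=> u v w; apply/tensor_liftD/bc_mul_balanced. Qed.

Lemma bc_mulC : commutative bc_mul.
Proof.
have mulDr u v w : bc_mul u (v + w) = bc_mul u v + bc_mul u w.
  elim/(@tensor_ind R A C): u => [x y|u1 u2 IH1 IH2].
    by rewrite /bc_mul !tensor_lift_pure ?bc_mullD//; exact: bc_mul_balanced.
  by rewrite !bc_mulDl IH1 IH2 addrACA.
move=> u v; elim/(@tensor_ind R A C): u => [x y|u1 u2 IH1 IH2]; last first.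
  by rewrite bc_mulDl mulDr IH1 IH2.
elim/(@tensor_ind R A C): v => [x' y'|v1 v2 IH1 IH2].
  by rewrite !bc_mul_pure mulrC [y * _]mulrC.
by rewrite bc_mulDl mulDr IH1 IH2.
Qed.

Lemma bc_mulDr : right_distributive bc_mul +%R.
Proof. by move=> u v w; rewrite bc_mulC bc_mulDl ![bc_mul _ u]bc_mulC. Qed.

Lemma bc_mulA : associative bc_mul.
Proof.
move=> u v w; elim/(@tensor_ind R A C): u => [x1 y1|u1 u2 IH1 IH2]; last first.
  by rewrite !bc_mulDl IH1 IH2.
elim/(@tensor_ind R A C): v => [x2 y2|u1 u2 IH1 IH2]; last first.
  by rewrite bc_mulDl !bc_mulDr bc_mulDl IH1 IH2.
elim/(@tensor_ind R A C): w => [x3 y3|u1 u2 IH1 IH2]; last first.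
  by rewrite !bc_mulDr IH1 IH2.
by rewrite !bc_mul_pure !mulrA.
Qed.

Lemma bc_mul1 : left_id bc_one bc_mul.
Proof.
move=> u; elim/(@tensor_ind R A C): u => [x y|u1 u2 IH1 IH2].
  by rewrite bc_mul_pure !mul1r.
by rewrite bc_mulDr IH1 IH2.
Qed.

HB.instance Definition _ := GRing.Zmodule_isComPzRing.Build T
  bc_mulA bc_mulC bc_mul1 bc_mulDl.

Lemma bc_scale_balanced c : balanced (fun x y => x *t (c * y)).
Proof.
split=> [x x' y|x y y'|a x y].
- by rewrite pure_tensorDl.
- by rewrite mulrDr pure_tensorDr.
- by rewrite -scalerAr pure_tensorZ.
Qed.

Lemma bc_scale_pure c x y : bc_scale c (x *t y) = x *t (c * y).
Proof. exact/tensor_lift_pure/bc_scale_balanced. Qed.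

Lemma bc_scaleDr : right_distributive bc_scale +%R.
Proof. by move=> c u v; apply/tensor_liftD/bc_scale_balanced. Qed.

Lemma bc_scaleA c d u : bc_scale c (bc_scale d u) = bc_scale (c * d) u.
Proof.
elim/(@tensor_ind R A C): u => [x y|u1 u2 IH1 IH2].
  by rewrite !bc_scale_pure mulrA.
by rewrite !bc_scaleDr IH1 IH2.
Qed.

Lemma bc_scale1 : left_id 1 bc_scale.
Proof.
move=> u; elim/(@tensor_ind R A C): u => [x y|u1 u2 IH1 IH2].
  by rewrite bc_scale_pure mul1r.
by rewrite bc_scaleDr IH1 IH2.
Qed.

Lemma bc_scaleDl u : {morph bc_scale^~ u : c d / c + d}.
Proof.
move=> c d; elim/(@tensor_ind R A C): u => [x y|u1 u2 IH1 IH2].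
  by rewrite !bc_scale_pure mulrDl pure_tensorDr.
by rewrite !bc_scaleDr IH1 IH2 addrACA.
Qed.

HB.instance Definition _ := GRing.Zmodule_isLmodule.Build C T
  bc_scaleA bc_scale1 bc_scaleDr bc_scaleDl.

End BaseChange.

Section Localization.
Variables (R : comNzRingType) (p : prime_idealr R).

(* Pairs (a, s) with s outside p, standing for the fraction a / s. *)
Definition prefrac : Type := {x : R * R | x.2 \notin p}.
HB.instance Definition _ := Choice.on prefrac.
Implicit Types (x y z : prefrac).

Local Notation num x := (val x).1.
Local Notation den x := (val x).2.

Lemma prime_compl1 : 1 \notin p. Proof. by rewrite idealr1. Qed.

Lemma prime_complM (a b : R) : a \notin p -> b \notin p -> a * b \notin p.
Proof. by rewrite prime_idealrM negb_or => -> ->. Qed.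

Lemma denP x : den x \notin p. Proof. exact: (valP x). Qed.

Definition mkfrac (a s : R) (sp : s \notin p) : prefrac := exist _ (a, s) sp.

Definition loc_equiv x y : bool :=
  `[< exists2 u, u \notin p & u * (num x * den y) = u * (num y * den x) >].

Lemma loc_equiv_class : equiv_class_of loc_equiv.
Proof.
have sym x y : loc_equiv x y -> loc_equiv y x.
  by move=> /asboolP[u up e]; apply/asboolP; exists u.
split=> [x|x y|y x z].
- by apply/asboolP; exists 1; first exact: prime_compl1.
- by apply/idP/idP; exact: sym.
- move=> /asboolP[u up e1] /asboolP[v vp e2]; apply/asboolP.
  exists (u * v * den y); first by rewrite !prime_complM ?denP.
  transitivity (v * den z * (u * (num x * den y))); first by ring.
  rewrite e1; transitivity (u * den x * (v * (num y * den z))); first by ring.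
  by rewrite e2; ring.
Qed.

Canonical loc_equivRel := EquivRelPack loc_equiv_class.
Canonical loc_encModRel := defaultEncModRel loc_equiv.

Definition localization := {eq_quot loc_equiv}.
HB.instance Definition _ : EqQuotient _ loc_equiv localization :=
  EqQuotient.on localization.
HB.instance Definition _ := Choice.on localization.

Definition loc_frac (a s : R) (sp : s \notin p) : localization :=
  \pi_localization (mkfrac a sp).

Lemma loc_fracP (a b s t : R) (sp : s \notin p) (tp : t \notin p) :
  loc_frac a sp = loc_frac b tp <->
  exists2 u, u \notin p & u * (a * t) = u * (b * s).
Proof. by split=> [/eqmodP/asboolP|h]//; apply/eqmodP/asboolP. Qed.

Lemma loc_frac_ind (P : localization -> Prop) :
  (forall a s (sp : s \notin p), P (loc_frac a sp)) -> forall f : localization, P f.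
Proof. by move=> Pf; elim/quotW=> -[[a s] sp]; exact: Pf. Qed.

Definition loc0 : localization := loc_frac 0 prime_compl1.
Definition loc1 : localization := loc_frac 1 prime_compl1.
Definition loc_add (f g : localization) : localization :=
  let x := repr f in let y := repr g in
  loc_frac (num x * den y + num y * den x) (prime_complM (denP x) (denP y)).
Definition loc_opp (f : localization) : localization :=
  let x := repr f in loc_frac (- num x) (denP x).
Definition loc_mul (f g : localization) : localization :=
  let x := repr f in let y := repr g in
  loc_frac (num x * num y) (prime_complM (denP x) (denP y)).

Lemma loc_repr a s (sp : s \notin p) : let x := repr (loc_frac a sp) in
  exists2 u, u \notin p & u * (num x * s) = u * (a * den x).
Proof.
have /eqmodP/asboolP// : repr (loc_frac a sp) = mkfrac a sp %[mod localization].
by rewrite reprK.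
Qed.

Lemma loc_addE a b s t (sp : s \notin p) (tp : t \notin p) :
  loc_add (loc_frac a sp) (loc_frac b tp) =
  loc_frac (a * t + b * s) (prime_complM sp tp).
Proof.
apply/loc_fracP; have [u up] := loc_repr a sp; have [v vp] := loc_repr b tp.
move: (repr (loc_frac a sp)) (repr (loc_frac b tp)) => x y e2 e1.
exists (u * v); first exact: prime_complM.
transitivity (v * t * den y * (u * (num x * s))
              + u * s * den x * (v * (num y * t))); first by ring.
by rewrite e1 e2; ring.
Qed.

Lemma loc_oppE a s (sp : s \notin p) :
  loc_opp (loc_frac a sp) = loc_frac (- a) sp.
Proof.
apply/loc_fracP; have [u up e1] := loc_repr a sp.
by exists u => //; rewrite !mulNr !mulrN e1.
Qed.

Lemma loc_mulE a b s t (sp : s \notin p) (tp : t \notin p) :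
  loc_mul (loc_frac a sp) (loc_frac b tp) =
  loc_frac (a * b) (prime_complM sp tp).
Proof.
apply/loc_fracP; have [u up] := loc_repr a sp; have [v vp] := loc_repr b tp.
move: (repr (loc_frac a sp)) (repr (loc_frac b tp)) => x y e2 e1.
exists (u * v); first exact: prime_complM.
transitivity ((u * (num x * s)) * (v * (num y * t))); first by ring.
by rewrite e1 e2; ring.
Qed.

Lemma loc_frac_eq (a b s t : R) (sp : s \notin p) (tp : t \notin p) :
  a * t = b * s -> loc_frac a sp = loc_frac b tp.
Proof. by move=> e; apply/loc_fracP; exists 1; rewrite ?prime_compl1 ?e. Qed.

Lemma loc_addA : associative loc_add.
Proof.
elim/loc_frac_ind=> a s sp; elim/loc_frac_ind=> b t tp; elim/loc_frac_ind=> c r rp.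
rewrite (loc_addE b c) (loc_addE a b) (loc_addE a) (loc_addE _ c).
by apply: loc_frac_eq; ring.
Qed.

Lemma loc_addC : commutative loc_add.
Proof.
elim/loc_frac_ind=> a s sp; elim/loc_frac_ind=> b t tp.
by rewrite (loc_addE a b) (loc_addE b a); apply: loc_frac_eq; ring.
Qed.

Lemma loc_add0 : left_id loc0 loc_add.
Proof.
elim/loc_frac_ind=> a s sp; rewrite (loc_addE 0 a).
by apply: loc_frac_eq; ring.
Qed.

Lemma loc_addN : left_inverse loc0 loc_opp loc_add.
Proof.
elim/loc_frac_ind=> a s sp; rewrite (loc_oppE a) (loc_addE _ a).
by apply: loc_frac_eq; ring.
Qed.

HB.instance Definition _ :=
  GRing.isZmodule.Build localization loc_addA loc_addC loc_add0 loc_addN.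

Lemma loc_mulA : associative loc_mul.
Proof.
elim/loc_frac_ind=> a s sp; elim/loc_frac_ind=> b t tp; elim/loc_frac_ind=> c r rp.
rewrite (loc_mulE b c) (loc_mulE a b) (loc_mulE a) (loc_mulE _ c).
by apply: loc_frac_eq; ring.
Qed.

Lemma loc_mulC : commutative loc_mul.
Proof.
elim/loc_frac_ind=> a s sp; elim/loc_frac_ind=> b t tp.
by rewrite (loc_mulE a b) (loc_mulE b a); apply: loc_frac_eq; ring.
Qed.

Lemma loc_mul1 : left_id loc1 loc_mul.
Proof.
elim/loc_frac_ind=> a s sp; rewrite (loc_mulE 1 a).
by apply: loc_frac_eq; ring.
Qed.

Lemma loc_mulDl : left_distributive loc_mul +%R.
Proof.
elim/loc_frac_ind=> a s sp; elim/loc_frac_ind=> b t tp; elim/loc_frac_ind=> c r rp.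
rewrite [X in loc_mul X _](loc_addE a b) (loc_mulE _ c) (loc_mulE a c).
rewrite (loc_mulE b c) [RHS]loc_addE.
by apply: loc_frac_eq; ring.
Qed.

Lemma loc1_neq0 : loc1 != 0.
Proof.
apply/eqP => /loc_fracP[u up]; rewrite mul1r mulr1 mul0r mulr0 => u0.
by move: up; rewrite u0 rpred0.
Qed.

HB.instance Definition _ := GRing.Zmodule_isComNzRing.Build localization
  loc_mulA loc_mulC loc_mul1 loc_mulDl loc1_neq0.

Lemma loc_fracD a b s t (sp : s \notin p) (tp : t \notin p) :
  loc_frac a sp + loc_frac b tp = loc_frac (a * t + b * s) (prime_complM sp tp).
Proof. exact: loc_addE. Qed.

Lemma loc_fracM a b s t (sp : s \notin p) (tp : t \notin p) :
  loc_frac a sp * loc_frac b tp = loc_frac (a * b) (prime_complM sp tp).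
Proof. exact: loc_mulE. Qed.

Definition loc_in (a : R) : localization := loc_frac a prime_compl1.

Lemma loc_in_zmod_morphism : zmod_morphism loc_in.
Proof.
move=> a b; have -> : - loc_in b = loc_in (- b) by exact: loc_oppE.
rewrite /loc_in loc_fracD.
by apply: loc_frac_eq; ring.
Qed.

Lemma loc_in_monoid_morphism : monoid_morphism loc_in.
Proof.
by split=> // a b; rewrite /loc_in loc_fracM; apply: loc_frac_eq; ring.
Qed.

HB.instance Definition _ :=
  GRing.isZmodMorphism.Build R localization loc_in loc_in_zmod_morphism.
HB.instance Definition _ :=
  GRing.isMonoidMorphism.Build R localization loc_in loc_in_monoid_morphism.

(* The ideal p R_p of R_p. *)
Definition loc_ideal (f : localization) : bool :=
  `[< exists a s (sp : s \notin p), a \in p /\ f = loc_frac a sp >].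

Lemma loc_idealP a s (sp : s \notin p) : (loc_frac a sp \in loc_ideal) = (a \in p).
Proof.
apply/idP/idP => [/asboolP[b [t [tp [bp /loc_fracP[u up e]]]]]|ap].
  have : u * (a * t) \in p by rewrite e !prime_idealrM bp orbT.
  by rewrite !prime_idealrM (negPf up) (negPf tp) orbF.
by apply/asboolP; exists a, s, sp.
Qed.

Lemma loc_ideal_closed : idealr_closed loc_ideal.
Proof.
split; rewrite ?loc_idealP ?rpred0 ?prime_compl1 //.
elim/loc_frac_ind=> a s sp; elim/loc_frac_ind=> b t tp.
elim/loc_frac_ind=> c r rp; rewrite loc_fracM loc_fracD !loc_idealP => bp cp.
by rewrite rpredD // prime_idealrM ?(prime_idealrM _ a) ?bp ?cp ?orbT.
Qed.

HB.instance Definition _ :=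
  isIdealr.Build localization loc_ideal loc_ideal_closed.

Definition loc_idealr : idealr localization :=
  Idealr.clone localization loc_ideal _.

Definition residue_field : Type := {ideal_quot loc_idealr}.
HB.instance Definition _ := GRing.ComNzRing.on residue_field.

Definition residue_in (a : R) : residue_field :=
  \pi_{ideal_quot loc_idealr} (loc_in a).

Lemma residue_in_zmod_morphism : zmod_morphism residue_in.
Proof. by move=> a b; rewrite /residue_in !rmorphB. Qed.

Lemma residue_in_monoid_morphism : monoid_morphism residue_in.
Proof. by rewrite /residue_in; split=> [|a b]; rewrite ?rmorph1 ?rmorphM. Qed.

HB.instance Definition _ :=
  GRing.isZmodMorphism.Build R residue_field residue_in residue_in_zmod_morphism.
HB.instance Definition _ :=
  GRing.isMonoidMorphism.Build R residue_field residue_in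
    residue_in_monoid_morphism.

Definition residue_scale (a : R) (v : residue_field) : residue_field :=
  residue_in a * v.

Lemma residue_scaleA a b v :
  residue_scale a (residue_scale b v) = residue_scale (a * b) v.
Proof. by rewrite /residue_scale rmorphM mulrA. Qed.

Lemma residue_scale1 : left_id 1 residue_scale.
Proof. by move=> v; rewrite /residue_scale rmorph1 mul1r. Qed.

Lemma residue_scaleDr : right_distributive residue_scale +%R.
Proof. by move=> a u v; rewrite /residue_scale mulrDr. Qed.

Lemma residue_scaleDl v : {morph residue_scale^~ v : a b / a + b}.
Proof. by move=> a b; rewrite /residue_scale rmorphD mulrDl. Qed.

HB.instance Definition _ := GRing.Zmodule_isLmodule.Build R residue_field
  residue_scaleA residue_scale1 residue_scaleDr residue_scaleDl.

Lemma residue_scaleAl (a : R) (u v : residue_field) :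
  a *: (u * v) = (a *: u) * v.
Proof. exact: mulrA. Qed.

HB.instance Definition _ :=
  GRing.Lmodule_isLalgebra.Build R residue_field residue_scaleAl.
HB.instance Definition _ := GRing.Lalgebra_isComAlgebra.Build R residue_field.

Lemma residue_fieldP (v : residue_field) : v != 0 -> exists w, v * w = 1.
Proof.
elim/quotW: v; elim/loc_frac_ind=> a s sp v0.
have ap : a \notin p.
  apply: contra v0 => ap; rewrite -[X in _ == X](rmorph0 \pi_{ideal_quot loc_idealr}).
  by rewrite -Quotient.idealrBE subr0; move: ap; rewrite -(loc_idealP a sp).
exists (\pi_{ideal_quot loc_idealr} (loc_frac s ap)).
rewrite -[LHS]rmorphM loc_fracM; rewrite -[RHS](rmorph1 \pi_{ideal_quot loc_idealr}).
by congr (\pi _); apply: loc_frac_eq; rewrite mul1r mulr1 mulrC.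
Qed.

End Localization.

(* The images of the variables under a surjective morphism of R-algebras
   R[X_0, ..., X_(m-1)] -> B. *)
Definition finite_type (R : comNzRingType) (B : comAlgType R) : Prop :=
  exists (m : nat) (b : 'I_m -> B),
    forall x : B, exists q : {mpoly R[m]}, x = mmap (GRing.in_alg B) b q.

Definition affine_fibration (n : nat) (R : comNzRingType) (B : comAlgType R) :
    Prop :=
  [/\ finite_type B, flat B &
      forall p : prime_idealr R,
        exists f : {rmorphism base_change B (residue_field p) ->
                               {mpoly (residue_field p)[n]}},
          bijective f /\ scalable f].

Definition derivation (R : comNzRingType) (B : comAlgType R)
    (D : {linear B -> B}) : Prop :=
  forall x y : B, D (x * y) = x * D y + y * D x.

Definition locally_nilpotent (R : comNzRingType) (B : comAlgType R)
    (D : {linear B -> B}) : Prop :=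
  forall b : B, exists n : nat, iter n D b = 0.

Definition contains_rat (R : comNzRingType) : Prop :=
  exists f : {rmorphism rat -> R}, injective f.

(* Main.v *)
(* Let I = D(B)B be proper, let P be a prime of B containing I, and let p be its
   contraction to R.  The fibre of B at p is a polynomial ring in two variables,
   which up to denominators outside p come from elements x, y of B; so for every
   b in B some s outside p satisfies s b = z + e with z in R[x, y] and e in pB,
   whence s D(b) lies in (D x, D y) + pI.  By Nakayama's lemma I is generated by
   D x and D y locally at P, and an ideal of a local ring generated by two
   non-units contains no regular sequence of length 3.  On the other hand I
   contains a nonzerodivisor, because flatness embeds B into its generic fibre,
   a polynomial ring over a field. *)
From HB Require Import structures.
Require Import Defs.
From mathcomp Require Import all_boot all_order all_algebra.
From mathcomp Require Import mpoly.
From mathcomp Require Import generic_quotient ring_quotient ring.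
From mathcomp Require Import boolp classical_sets constructive_ereal.

Set Implicit Arguments.
Unset Strict Implicit.
Unset Printing Implicit Defensive.

Import GRing.Theory.

Local Open Scope ring_scope.
Local Open Scope quotient_scope.
Local Open Scope classical_set_scope.

(** * Ideals generated by finite sequences *)

Section Ideals.
Variable S : comNzRingType.
Implicit Types (I J P A : set S) (s w : seq S).

Lemma ideal_gen_ideal A : is_ideal (ideal_gen A).
Proof.
split=> [J [[]]//|x y Ix Iy J JA|a x Ix J JA]; have [[_ JD JM] _] := JA.
  by apply: JD; [exact: Ix|exact: Iy].
by apply: JM; exact: Ix.
Qed.

Lemma sub_ideal_gen A : A `<=` ideal_gen A.
Proof. by move=> x Ax J [_]; apply. Qed.

Lemma ideal_gen_sub A J : is_ideal J -> A `<=` J -> ideal_gen A `<=` J.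
Proof. by move=> Jid AJ x; apply. Qed.

Lemma ideal_proper I : is_ideal I -> (I <> setT) <-> ~ I 1.
Proof.
move=> [_ _ IM]; split; last by apply: contra_not => ->.
apply: contra_not => I1.
by apply/seteqP; split=> // x _; rewrite -[x]mulr1; exact: IM.
Qed.

Lemma ideal_colon I a : is_ideal I -> is_ideal [set x | I (a * x)].
Proof.
move=> [I0 ID IM]; split=> /= [|x y Ix Iy|b x Ix]; first by rewrite mulr0.
  by rewrite mulrDr; exact: ID.
by rewrite mulrCA; exact: IM.
Qed.

Lemma ideal_gen_nil x : ideal_gen [set` Nil S] x <-> x = 0.
Proof.
split=> [|->]; last by case: (ideal_gen_ideal [set` Nil S]).
apply: (@ideal_gen_sub _ [set 0]) => //; split=> //= [y z -> ->|a y ->].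
  by rewrite addr0.
by rewrite mulr0.
Qed.

(** Generators are peeled off one at a time, so that membership never involves indexed linear
    combinations; the forms for one and two generators used later follow by iteration. *)
Lemma ideal_gen_cons a s x :
  ideal_gen [set` a :: s] x <-> exists c, ideal_gen [set` s] (x - c * a).
Proof.
have [s0 sD sM] := ideal_gen_ideal [set` s].
have [g0 gD gM] := ideal_gen_ideal [set` a :: s].
split=> [|[c sx]].
  apply: (@ideal_gen_sub _ [set x | exists c, ideal_gen [set` s] (x - c * a)]).
    split=> [|y z [c sy] [d sz]|b y [c sy]].
    - by exists 0; rewrite mul0r subr0.
    - exists (c + d); rewrite (_ : _ - _ = (y - c * a) + (z - d * a)); first exact: sD.
      by ring.
    - exists (b * c); rewrite (_ : _ - _ = b * (y - c * a)); first exact: sM.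
      by ring.
  move=> y /=; rewrite inE => /orP[/eqP ->|ys].
    by exists 1; rewrite mul1r subrr.
  by exists 0; rewrite mul0r subr0; exact: sub_ideal_gen.
rewrite -(subrK (c * a) x); apply: gD; last first.
  by apply: gM; apply: sub_ideal_gen; exact: mem_head.
apply: (ideal_gen_sub (ideal_gen_ideal _)) sx => y ys.
by apply: sub_ideal_gen; exact: (@mem_behead _ (a :: s)).
Qed.

Lemma ideal_gen1 a x : @ideal_gen S [set` [:: a]] x <-> exists c, x = c * a.
Proof.
rewrite ideal_gen_cons; split=> -[c].
  by move=> /ideal_gen_nil/eqP; rewrite subr_eq0 => /eqP ->; exists c.
by move=> ->; exists c; apply/ideal_gen_nil; rewrite subrr.
Qed.

Lemma ideal_gen2 a b x :
  @ideal_gen S [set` [:: a; b]] x <-> exists c d, x = c * a + d * b.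
Proof.
rewrite ideal_gen_cons; split=> -[c].
  by move=> /ideal_gen1[d e]; exists c, d; rewrite -e; ring.
by move=> [d ->]; exists c; apply/ideal_gen1; exists d; ring.
Qed.

(** * Prime ideals, Nakayama's lemma at a prime, and lengths of regular sequences *)

Definition prime_ideal P :=
  [/\ is_ideal P, ~ P 1 & forall x y, P (x * y) -> P x \/ P y].

Lemma exists_prime_ideal I : is_ideal I -> ~ I 1 ->
  exists P, prime_ideal P /\ I `<=` P.
Proof.
move=> Iid I1.
pose Q J := J = set0 \/ [/\ is_ideal J, ~ J 1 & I `<=` J].
have I0 : I 0 by case: Iid.
have [|P [QP Pmax]] := @Zorn_bigcup S Q.
  move=> F FQ Ftot.
  have [F0|] := pselect (forall X, F X -> X = set0).
    left; apply/seteqP; split=> // x [X FX]; by rewrite (F0 _ FX).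
  move=> /existsNP[X0 /not_implyP[FX0 X0n]]; right.
  have [//|[X0id _ IX0]] := FQ _ FX0.
  have Fid X x : F X -> X x -> is_ideal X.
    by move=> FX Xx; case: (FQ _ FX) => [X0'|[]//]; rewrite X0' in Xx.
  split.
  - split=> [|x y [X FX Xx] [Y FY Yy]|a x [X FX Xx]].
    + by exists X0 => //; case: X0id.
    + case: (Ftot _ _ FX FY) => XY.
        by exists Y => //; case: (Fid _ _ FY Yy) => _ YD _; apply: YD => //; exact: XY.
      by exists X => //; case: (Fid _ _ FX Xx) => _ XD _; apply: XD => //; exact: XY.
    + by exists X => //; case: (Fid _ _ FX Xx) => _ _; apply.
  - by move=> [X FX X1]; case: (FQ _ FX) => [X0'|[]//]; rewrite X0' in X1.
  - by move=> x Ix; exists X0 => //; exact: IX0.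
have [Pid P1 IP] : [/\ is_ideal P, ~ P 1 & I `<=` P].
  case: QP => // P0; exfalso; apply: (Pmax I); last by right; split.
  by rewrite P0; split=> [x []|/(_ _ I0)].
exists P; split=> //; split=> // x y Pxy.
have [|nPx] := pselect (P x); [by left|right].
have [P0 PD PM] := Pid.
(* [J] is P + (x). If it contains 1 = q + r x, then y = q y + r x y lies in [P]; otherwise it
   contradicts the maximality of [P]. *)
pose J := [set z | exists2 q, P q & exists r, z = q + r * x].
have [[q Pq [r e]]|J1] := pselect (J 1).
  by rewrite -[y]mul1r e mulrDl -mulrA mulrC; apply: PD; exact: PM.
exfalso; apply: (Pmax J).
  split=> [z Pz|JP]; first by exists z => //; exists 0; ring.
  by apply/nPx/JP; exists 0 => //; exists 1; ring.
right; split=> //.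
- split=> [|z t [q Pq [r ->]] [q' Pq' [r' ->]]|a z [q Pq [r ->]]].
  + by exists 0 => //; exists 0; ring.
  + by exists (q + q'); [exact: PD|exists (r + r'); ring].
  + by exists (a * q); [exact: PM|exists (a * r); ring].
- by move=> z /IP Pz; exists z => //; exists 0; ring.
Qed.

(* The ideal J + P w. *)
Fixpoint ideal_add_mul J P w : set S :=
  if w is a :: w' then [set x | exists2 c, P c & ideal_add_mul J P w' (x - c * a)]
  else J.

Lemma ideal_add_mul_ideal J P w :
  is_ideal J -> is_ideal P -> is_ideal (ideal_add_mul J P w).
Proof.
move=> Jid [P0 PD PM]; elim: w => //= a w [w0 wD wM].
split=> [|x y [c Pc wx] [d Pd wy]|b x [c Pc wx]].
- by exists 0; rewrite // mul0r subr0.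
- exists (c + d); first exact: PD.
  by rewrite (_ : _ - _ = (x - c * a) + (y - d * a)); [exact: wD|ring].
- exists (b * c); first exact: PM.
  by rewrite (_ : _ - _ = b * (x - c * a)); [exact: wM|ring].
Qed.

Lemma ideal_add_mul_subl J P w : is_ideal P -> J `<=` ideal_add_mul J P w.
Proof.
move=> [P0 _ _]; elim: w => //= a w IH x /IH wx.
by exists 0; rewrite // mul0r subr0.
Qed.

Lemma ideal_add_mul_mem J P w c a : is_ideal J -> is_ideal P ->
  P c -> a \in w -> ideal_add_mul J P w (c * a).
Proof.
move=> Jid Pid Pc; elim: w => //= b w IH; rewrite inE => /orP[/eqP <-|aw].
  by exists c => //; rewrite subrr; case: (ideal_add_mul_ideal w Jid Pid).
by exists 0; [case: Pid|rewrite mul0r subr0; exact: IH].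
Qed.

Lemma ideal_add_mul_smul J P w d x : is_ideal J -> is_ideal P ->
  (forall a, a \in w -> J (d * a)) -> ideal_add_mul J P w x -> J (d * x).
Proof.
move=> Jid Pid; have [_ JD JM] := Jid; elim: w x => [|a w IH] x dw /=; first exact: JM.
move=> [c _ /IH wx]; rewrite (_ : d * x = d * (x - c * a) + c * (d * a)); last by ring.
apply: JD; first by apply: wx => b bw; apply: dw; rewrite inE bw orbT.
by apply/JM/dw; rewrite inE eqxx.
Qed.

(* Nakayama's lemma for the ideal (w) of the localization at P. *)
Lemma local_nakayama J P w : is_ideal J -> prime_ideal P ->
  (forall a, a \in w -> exists2 t, ~ P t & ideal_add_mul J P w (t * a)) ->
  exists2 d, ~ P d & forall a, a \in w -> J (d * a).
Proof.
move=> Jid [Pid P1 Pprime]; have [_ JD JM] := Jid.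
elim: w => [|a w IH] Hw; first by exists 1.
have [t nPt [c Pc wa]] := Hw a (mem_head _ _).
have [w0 wD wM] := ideal_add_mul_ideal w Jid Pid.
(* Gaussian elimination: moving [c * a] to the left gives [a] the coefficient [t - c], a unit at
   [P]. So [a] can be eliminated from the relations of the remaining generators, and is recovered at
   the end from its own relation. *)
have nPtc : ~ P (t - c).
  by move=> Ptc; apply: nPt; rewrite -(subrK c t); case: Pid => _ PD _; exact: PD.
rewrite -mulrBl in wa.
have [b bw|d nPd dw] := IH.
  have [|t' nPt' [c' Pc' wb]] := Hw b; first by rewrite inE bw orbT.
  exists ((t - c) * t'); first by move=> /Pprime[].
  rewrite (_ : _ * b = (t - c) * (t' * b - c' * a) + c' * ((t - c) * a)); last by ring.
  by apply: wD; exact: wM.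
exists (d * (t - c)); first by move=> /Pprime[].
move=> b; rewrite inE -mulrA => /orP[/eqP ->|bw].
  exact: (ideal_add_mul_smul Jid Pid dw wa).
by rewrite mulrCA; exact/JM/dw.
Qed.

(* Up to the denominator [d], write [a1 = al u + be v] and [a2 = ga u + ep v].
   By Cramer's rule the determinant [D] of these two rows multiplies [u] and [v]
   into [(a1, a2)], so [D a3], hence [D], lies in [(a1, a2)]; regularity of
   [a1, a2] then turns the Cramer relations into [d ^+ 3] in [(u, v)]. *)
Lemma regular_seq_local2 P (d u v : S) s :
  prime_ideal P -> P u -> P v -> ~ P d -> regular_seq s ->
  (forall a, a \in s -> @ideal_gen S [set` [:: u; v]] (d * a)) ->
  (size s <= 2)%N.
Proof.
move=> [[P0 PD PM] P1 Pprime] Pu Pv nPd [sreg _] sd.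
case: s sreg sd => [|a1 [|a2 [|a3 s]]]// sreg sd; exfalso.
have reg1 b : a1 * b = 0 -> b = 0.
  by move=> e; apply/ideal_gen_nil; apply: (sreg 0%N isT); apply/ideal_gen_nil.
have reg2 b c : a2 * b = c * a1 -> exists e, b = e * a1.
  move=> e; apply/ideal_gen1.
  by apply: (sreg 1%N isT); rewrite /= ?take0; apply/ideal_gen1; exists c.
have reg3 b c e : a3 * b = c * a1 + e * a2 -> exists c e, b = c * a1 + e * a2.
  move=> h; apply/ideal_gen2.
  by apply: (sreg 2%N isT); rewrite /= ?take0; apply/ideal_gen2; exists c, e.
have canc1 b c : a1 * b = a1 * c -> b = c.
  by move=> h; apply/eqP; rewrite -subr_eq0; apply/eqP/reg1; rewrite mulrBr h subrr.
have [al [be e1]] := (ideal_gen2 _ _ _).1 (sd a1 (mem_head _ _)).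
have [|ga [ep e2]] := (ideal_gen2 _ _ _).1 (sd a2 _); first by rewrite !inE eqxx orbT.
have [|k [l e3]] := (ideal_gen2 _ _ _).1 (sd a3 _); first by rewrite !inE eqxx !orbT.
pose D := al * ep - be * ga.
have Du : D * u = d * (ep * a1 - be * a2).
  transitivity (ep * (d * a1) - be * (d * a2)); last by ring.
  by rewrite e1 e2 /D; ring.
have Dv : D * v = d * (al * a2 - ga * a1).
  transitivity (al * (d * a2) - ga * (d * a1)); last by ring.
  by rewrite e1 e2 /D; ring.
have [|la [mu eD]] := reg3 (d * D) (d * (k * ep - l * ga)) (d * (l * al - k * be)).
  transitivity (D * (d * a3)); first by ring.
  rewrite e3; transitivity (k * (D * u) + l * (D * v)); first by ring.
  by rewrite Du Dv; ring.
(* Comparing the two expressions for d D u gives a2 (d^2 be + mu u) = (d^2 ep - la u) a1, and a2 is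
   regular modulo a1. The same with [v] gives [si]; the terms in mu u v then cancel in d^3 a1. *)
have [ta eta] : exists ta, d ^+ 2 * be + mu * u = ta * a1.
  apply: (reg2 _ (d ^+ 2 * ep - la * u)).
  apply/subr0_eq; rewrite -[RHS](subrr (d * (D * u))) [X in _ = X - _]mulrA eD Du.
  by ring.
have [si esi] : exists si, d ^+ 2 * al - mu * v = si * a1.
  apply: (reg2 _ (d ^+ 2 * ga + la * v)).
  apply/subr0_eq; rewrite -[RHS](subrr (d * (D * v))) [X in _ = _ - X]mulrA eD Dv.
  by ring.
have : d ^+ 3 = si * u + ta * v.
  apply: canc1; transitivity (d ^+ 2 * (d * a1)); first by ring.
  rewrite e1; transitivity ((d ^+ 2 * al - mu * v) * u + (d ^+ 2 * be + mu * u) * v).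
    by ring.
  by rewrite eta esi; ring.
move=> e; have : P (d ^+ 3) by rewrite e; apply: PD; exact: PM.
by rewrite !exprS expr0 mulr1 => /Pprime[//|/Pprime[]].
Qed.

(** The length bound yields a maximal regular sequence: either [[:: a]] is maximal, or it extends to
    a sequence of length two, which the bound makes maximal. Hence [xget] returns the length of an
    actual maximal sequence; this length is at most 2, and it is not 0 because [a] extends the empty
    sequence. *)
Lemma grade_le2 I a :
  is_ideal I -> I <> setT -> I a -> (forall b, a * b = 0 -> b = 0) ->
  (forall s, regular_seq s -> [set` s] `<=` I -> (size s <= 2)%N) ->
  grade I = EFin 1%N \/ grade I = EFin 2%N.
Proof.
move=> Iid Iprop Ia areg bound; rewrite /grade asboolF//.
have reg1 : regular_seq [:: a].
  split=> [[|//] _ b /=|e].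
    by move=> /ideal_gen_nil/areg ->; apply/ideal_gen_nil.
  apply: Iprop; apply/seteqP; split=> // x _.
  have : @ideal_gen S [set` [:: a]] x by rewrite e.
  by apply: ideal_gen_sub => // y; rewrite /= inE => /eqP ->.
have sub1 : [set` [:: a]] `<=` I by move=> y; rewrite /= inE => /eqP ->.
set X := [set n | _].
have [n Xn] : exists n, X n.
  have [max1|] := pselect (maximal_regular_seq_in I [:: a]).
    by exists 1%N; exists [:: a].
  move=> /not_and3P[//|//|/existsNP[b /not_implyP[Ib /contrapT reg2]]].
  have sub2 : [set` [:: a; b]] `<=` I.
    by move=> y; rewrite /= !inE => /orP[] /eqP ->.
  exists 2%N; exists [:: a; b] => //; split=> // c Ic reg3.
  have : (size (rcons [:: a; b] c) <= 2)%N.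
    by apply: bound => // y; rewrite /= !inE => /or3P[] /eqP ->.
  by [].
have [s [sreg sI smax] ssize] : X (xget 0%N X) by apply: xgetI Xn.
have : (size s <= 2)%N by exact: bound.
rewrite -ssize; case: s sreg sI smax {ssize} => [_ _ smax|x [|y []]]//=; [|by left|by right].
by case: (smax a Ia).
Qed.

End Ideals.

(** * Fractions in the residue field, and the kernel of the map from B to its fibre *)

Section ResidueField.
Variables (R : comNzRingType) (p : prime_idealr R).
Local Notation k := (residue_field p).

Lemma residue_in_eq0 (a : R) : (residue_in p a == 0) = (a \in p).
Proof.
rewrite -[0](rmorph0 \pi_{ideal_quot (loc_idealr p)}).
by rewrite -Quotient.idealrBE subr0 loc_idealP.
Qed.

Lemma residue_frac (c : k) :
  exists z : R * R, z.2 \notin p /\ residue_in p z.2 * c = residue_in p z.1.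
Proof.
elim/quotW: c; elim/loc_frac_ind=> a s sp; exists (a, s); split=> //=.
rewrite /residue_in -[LHS]rmorphM loc_fracM; congr (\pi _).
by apply: loc_frac_eq; rewrite mulr1 mul1r mulrC.
Qed.

Lemma residue_mulf_eq0 (c d : k) : c * d = 0 -> c = 0 \/ d = 0.
Proof.
move=> cd0; case: (eqVneq c 0) => [|/residue_fieldP[e ce]]; [by left|right].
by rewrite -[d]mul1r -ce [c * e]mulrC -mulrA cd0 mulr0.
Qed.

End ResidueField.

Section Fibre.
Variables (R : comNzRingType) (B : comAlgType R) (p : prime_idealr R).
Local Notation k := (residue_field p).
Local Notation T := (base_change B k).
Implicit Types (x y b : B) (a s : R) (c : k).

Definition fibre_in x : T := pure_tensor x 1.

Lemma fibre_inD x y : fibre_in (x + y) = fibre_in x + fibre_in y.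
Proof. exact: pure_tensorDl. Qed.

Lemma fibre_inM x y : fibre_in (x * y) = fibre_in x * fibre_in y.
Proof. by rewrite [RHS]bc_mul_pure mulr1. Qed.

Lemma fibre_inZ a x : fibre_in (a *: x) = residue_in p a *: fibre_in x.
Proof.
rewrite [RHS]bc_scale_pure mulr1 /fibre_in [LHS]pure_tensorZ; congr pure_tensor.
exact: mulr1.
Qed.

Lemma fibre_in0 : fibre_in 0 = 0. Proof. exact: pure_tensor0l. Qed.

Lemma fibre_in1 : fibre_in 1 = 1. Proof. by []. Qed.

Lemma fibre_frac (t : T) :
  exists x s, s \notin p /\ residue_in p s *: t = fibre_in x.
Proof.
elim/(@tensor_ind R B k): t => [x c|u v [x [s [sp e]]] [y [r [rp f]]]].
  have [[a s] [/= sp e]] := residue_frac c; exists (a *: x), s; split=> //.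
  by rewrite [LHS]bc_scale_pure e fibre_inZ [RHS]bc_scale_pure mulr1.
exists (r *: x + s *: y), (s * r); split; first exact: prime_complM.
rewrite fibre_inD !fibre_inZ -e -f !scalerA -!rmorphM scalerDr.
by rewrite [r * s]mulrC.
Qed.

Definition extended_ideal : set B :=
  ideal_gen [set x | exists2 a, a \in p & x = a%:A].

(** The kernel of the map from B to the localization of B / pB at p, which is another description of
    the fibre of B at p. *)
Definition local_ideal : set B :=
  [set x | exists2 s, s \notin p & extended_ideal (s *: x)].

Local Notation N := local_ideal.

Lemma extended_ideal_scale a x : a \in p -> extended_ideal (a *: x).
Proof.
move=> ap; have [_ _ EM] := ideal_gen_ideal [set x : B | exists2 a, a \in p & x = a%:A].
rewrite -mulr_algr; apply: EM; apply: sub_ideal_gen; by exists a.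
Qed.

Lemma extended_ideal_stable a x : extended_ideal x -> extended_ideal (a *: x).
Proof.
have [_ _ EM] := ideal_gen_ideal [set x : B | exists2 a, a \in p & x = a%:A].
by rewrite -mulr_algl; apply: EM.
Qed.

Lemma local_idealD x y : N x -> N y -> N (x + y).
Proof.
have [_ ED _] := ideal_gen_ideal [set x : B | exists2 a, a \in p & x = a%:A].
move=> [s sp Ex] [r rp Ey]; exists (r * s); first exact: prime_complM.
rewrite scalerDr; apply: ED.
  by rewrite -scalerA; exact: extended_ideal_stable.
by rewrite mulrC -scalerA; exact: extended_ideal_stable.
Qed.

Lemma local_idealZ a x : N x -> N (a *: x).
Proof.
move=> [s sp Ex]; exists s => //.
by rewrite scalerA mulrC -scalerA; exact: extended_ideal_stable.
Qed.

Lemma local_ideal_sat s x : s \notin p -> N (s *: x) -> N x.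
Proof.
move=> sp [r rp Ex]; exists (r * s); first exact: prime_complM.
by rewrite -scalerA.
Qed.

Lemma local_ideal_scale a x : a \in p -> N (a *: x).
Proof.
move=> ap; exists 1; first exact: prime_compl1.
by rewrite scale1r; exact: extended_ideal_scale.
Qed.

Lemma local_ideal0 : N 0.
Proof. by rewrite -(scale0r 0); apply: local_ideal_scale; exact: rpred0. Qed.

Definition frac c : R * R := sval (cid (residue_frac c)).

Lemma fracP c :
  (frac c).2 \notin p /\ residue_in p (frac c).2 * c = residue_in p (frac c).1.
Proof. by rewrite /frac; case: cid. Qed.

(* The pair (b, s) stands for the fraction b / s in the localization of
   B / pB at p. *)
Definition fib_equiv (f g : B * R) : Prop := N (g.2 *: f.1 - f.2 *: g.1).

(** The map from the tensor product to the localization of B / pB, on representatives: with c = a /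
    r, the term x (x) c goes to a x / r, and fractions are added by cross-multiplication. The choice
    made by [frac] does not respect the operations of [k], so relations are preserved only up to
    [fib_equiv]. *)
Fixpoint fib_eval (t : seq (B * k)) : B * R :=
  if t is (x, c) :: t' then
    let: (b, s) := fib_eval t' in let: (a, r) := frac c in
    (r *: b + (a * s) *: x, r * s)
  else (0, 1).

Lemma fib_eval_den t : (fib_eval t).2 \notin p.
Proof.
elim: t => [|[x c] t] /=; first exact: prime_compl1.
case: (fib_eval t) (fracP c) => b s; case: (frac c) => a r /= [rp _] sp.
exact: prime_complM.
Qed.

Lemma fib_eval_cat t u :
  fib_eval (t ++ u) =
  ((fib_eval u).2 *: (fib_eval t).1 + (fib_eval t).2 *: (fib_eval u).1,
   (fib_eval t).2 * (fib_eval u).2).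
Proof.
elim: t => [|[x c] t /= ->] /=.
  by rewrite scaler0 scale1r add0r mul1r; case: (fib_eval u).
case: (fib_eval t) => b s; case: (frac c) => a r; case: (fib_eval u) => b' s' /=.
rewrite !scalerDr !scalerA; congr pair; last exact: mulrA.
by rewrite addrAC; congr (_ *: _ + _ *: _ + _); ring.
Qed.

Lemma fib_equiv_refl f : fib_equiv f f.
Proof. by rewrite /fib_equiv subrr; exact: local_ideal0. Qed.

Lemma fib_equiv_sym f g : fib_equiv f g -> fib_equiv g f.
Proof. by move=> /(local_idealZ (-1)); rewrite scaleN1r opprB. Qed.

Lemma fib_equiv_trans f g h :
  g.2 \notin p -> fib_equiv f g -> fib_equiv g h -> fib_equiv f h.
Proof.
rewrite /fib_equiv => gp fg gh; apply: (local_ideal_sat gp).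
rewrite (_ : _ *: _ = h.2 *: (g.2 *: f.1 - f.2 *: g.1) + f.2 *: (h.2 *: g.1 - g.2 *: h.1)).
  by apply: local_idealD; exact: local_idealZ.
rewrite !scalerBr !scalerA addrA [f.2 * h.2]mulrC subrK.
by rewrite [g.2 * h.2]mulrC [g.2 * f.2]mulrC.
Qed.

(** This makes [fib_eval] well defined on the tensor product. For additivity in [k] and for moving a
    scalar across, the difference is a multiple of [x] whose coefficient has residue 0, hence lies
    in [p]. *)
Lemma fib_eval_rel t u : tensor_rel t u -> fib_equiv (fib_eval t) (fib_eval u).
Proof.
elim=> {t u} [t|t u _|t u v _ IH1 _|t t' u u' _ IH1 _ IH2|t u|c|x x' c|x c d|a x c].
- exact: fib_equiv_refl.
- exact: fib_equiv_sym.
- by apply: fib_equiv_trans IH1; exact: fib_eval_den.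
- rewrite !fib_eval_cat /fib_equiv /=.
  move: IH1 IH2; rewrite /fib_equiv.
  move: (fib_eval t) (fib_eval t') (fib_eval u) (fib_eval u').
  move=> [b s] [b' s'] [c r] [c' r'] /= IH1 IH2.
  rewrite (_ : _ - _ = (r * r') *: (s' *: b - s *: b') + (s * s') *: (r' *: c - r *: c')).
    by apply: local_idealD; exact: local_idealZ.
  rewrite !scalerDr !scalerN !scalerA opprD addrACA.
  by congr (_ *: _ - _ *: _ + (_ *: _ - _ *: _)); ring.
- rewrite !fib_eval_cat /fib_equiv /=.
  rewrite [X in N X](_ : _ = 0); first exact: local_ideal0.
  rewrite [X in _ *: X - _]addrC [X in X *: _ - _]mulrC; exact: subrr.
- rewrite /fib_equiv /=; case: (frac c) => a r /=.
  rewrite !scaler0 !addr0 !subr0 scale1r; exact: local_ideal0.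
- rewrite /fib_equiv /=; case: (frac c) => a r /=.
  rewrite [X in N X](_ : _ = 0); first exact: local_ideal0.
  rewrite !scaler0 !add0r !mulr1 !scalerDr !scalerA; apply/eqP.
  by rewrite subr_eq0 addrC; apply/eqP; congr (_ *: _ + _ *: _); ring.
- rewrite /fib_equiv /=.
  have [] := fracP c; have [] := fracP d; have [] := fracP (c + d).
  case: (frac (c + d)) => a r; case: (frac c) => a1 r1; case: (frac d) => a2 r2 /=.
  move=> rp e r2p e2 r1p e1.
  rewrite (_ : _ - _ = (r1 * r2 * a - r * (r2 * a1 + r1 * a2)) *: x).
    apply: local_ideal_scale; rewrite -residue_in_eq0 rmorphB !rmorphM rmorphD !rmorphM /=.
    by rewrite -e -e1 -e2 subr_eq0; apply/eqP; ring.
  rewrite !scaler0 !add0r !mulr1 !scalerDr !scalerA -!scalerDl -scalerBl.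
  by congr (_ *: _); ring.
- rewrite /fib_equiv /=.
  have [] := fracP c; have [] := fracP (a *: c).
  case: (frac c) => a1 r1; case: (frac (a *: c)) => a2 r2 /= r2p e2 r1p e1.
  rewrite (_ : _ - _ = (r2 * a1 * a - r1 * a2) *: x).
    apply: local_ideal_scale; rewrite -residue_in_eq0 rmorphB !rmorphM /=.
    have e : a *: c = residue_in p a * c by [].
    by rewrite -e1 -e2 e subr_eq0; apply/eqP; ring.
  rewrite !scaler0 !add0r !mulr1 !scalerA -scalerBl.
  by congr (_ *: _); ring.
Qed.

Lemma fibre_in_eq0 x : fibre_in x = 0 -> N x.
Proof.
have zero : (0 : T) = \pi_(tensor B k) [::] by [].
(* The representatives [[:: (x, 1)]] and [[::]] are evaluated. The first gives a x / r with a / r =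
   1 in [k], so [a] is outside [p] and can be cancelled. *)
rewrite zero => /tensor_piP/fib_eval_rel.
rewrite /fib_equiv /=; have [] := fracP 1; case: (frac 1) => a r /= rp.
rewrite mulr1 => e; rewrite !scaler0 !add0r mulr1 scale1r subr0.
apply: local_ideal_sat; rewrite -residue_in_eq0 -e residue_in_eq0.
exact: rp.
Qed.

End Fibre.

(** * Lifting the variables of the fibre to B *)

Definition subalgebra (R : comNzRingType) (B : comAlgType R) (A : set B) : Prop :=
  [/\ forall a, A a%:A, forall x y, A x -> A y -> A (x + y) &
      forall x y, A x -> A y -> A (x * y)].

(* [k] is abstract because with [residue_field p] in its place unification
   unfolds the quotients and diverges. *)
Lemma mpoly_frac_subalgebra (R k : comNzRingType) (B : comAlgType R)
    (p : prime_idealr R) (r : {rmorphism R -> k}) (n : nat)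
    (phi : B -> {mpoly k[n]}) (A : set B) :
  (forall x y, phi (x + y) = phi x + phi y) ->
  (forall x y, phi (x * y) = phi x * phi y) ->
  (forall a x, phi (a *: x) = r a *: phi x) -> phi 1 = 1 ->
  (forall c, exists z : R * R, z.2 \notin p /\ r z.2 * c = r z.1) ->
  subalgebra A ->
  (forall i, exists2 s, s \notin p & exists2 z, A z & r s *: 'X_i = phi z) ->
  forall Q, exists2 s, s \notin p & exists2 z, A z & r s *: Q = phi z.
Proof.
move=> phiD phiM phiZ phi1 rfrac [Aalg AD AM] AX.
(* [G] is closed under sums and products and contains the constants and the variables, hence every
   polynomial. *)
pose G Q := exists2 s, s \notin p & exists2 z, A z & r s *: Q = phi z.
have GC c : G c%:MP.
  have [[a s] [/= sp e]] := rfrac c; exists s => //.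
  exists a%:A; first exact: Aalg.
  by rewrite phiZ phi1 -mul_mpolyC -mpolyCM e -mul_mpolyC mulr1.
have GM Q Q' : G Q -> G Q' -> G (Q * Q').
  move=> [s sp [z Az e]] [s' sp' [z' Az' e']].
  exists (s * s'); first exact: prime_complM.
  exists (z * z'); first exact: AM.
  by rewrite phiM -e -e' rmorphM -scalerAl -scalerAr scalerA.
have GD Q Q' : G Q -> G Q' -> G (Q + Q').
  move=> [s sp [z Az e]] [s' sp' [z' Az' e']].
  exists (s * s'); first exact: prime_complM.
  exists (s'%:A * z + s%:A * z'); first by apply: AD; apply: AM.
  rewrite !mulr_algl phiD !phiZ -e -e' rmorphM scalerDr !scalerA.
  by rewrite [X in X *: Q]mulrC.
have GX m : G 'X_[m].
  rewrite mpolyXE_id; apply: (big_ind G) => // [|i _].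
    by rewrite -mpolyC1.
  elim: (m i) => [|e IH]; first by rewrite expr0 -mpolyC1.
  by rewrite exprS; apply: GM => //; exact: AX.
elim/mpolyind=> [|c m Q _ _ IH]; first by rewrite -mpolyC0; exact: GC.
by apply: GD => //; rewrite -mul_mpolyC; exact: GM.
Qed.

(** The [x i] are the variables of the fibre with denominators cleared. Quantifying over all
    subalgebras [A] that contain them stands for the subalgebra they generate. The [x i] are chosen
    before [A] because the subalgebra used later, of elements whose derivative lies in (D x_0, D
    x_1), depends on them. *)
Lemma fibre_generators (R : comNzRingType) (B : comAlgType R) (p : prime_idealr R)
    (n : nat) (f : {rmorphism base_change B (residue_field p) ->
                      {mpoly (residue_field p)[n]}}) :
  bijective f -> scalable f ->
  exists x : 'I_n -> B, forall A : set B, subalgebra A -> (forall i, A (x i)) ->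
    forall b, exists2 s, s \notin p & exists2 z, A z & local_ideal p (s *: b - z).
Proof.
move=> [g fK gK] fZ; pose phi x := f (fibre_in p x).
have /choice[x xP] i : exists y : B, exists2 s, s \notin p &
    residue_in p s *: 'X_i = phi y.
  have [y [s [sp e]]] := fibre_frac (g 'X_i); exists y; exists s => //.
  by rewrite /phi -e fZ gK.
have phiZ a y : phi (a *: y) = residue_in p a *: phi y.
  by rewrite /phi fibre_inZ fZ.
have phiD y z : phi (y + z) = phi y + phi z by rewrite /phi fibre_inD rmorphD.
exists x => A Aalg Ax b.
have [|||i|s sp [z Az e]] :=
    @mpoly_frac_subalgebra R _ B p (residue_in p) n phi A phiD _ phiZ _ _ Aalg _ (phi b).
- by move=> y z; rewrite /phi fibre_inM rmorphM.
- by rewrite /phi fibre_in1 rmorph1.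
- exact: residue_frac.
- by have [s sp e] := xP i; exists s => //; exists (x i).
exists s => //; exists z => //; apply: fibre_in_eq0; apply: (can_inj fK).
rewrite rmorph0 -/(phi _); apply: (addIr (phi z)).
by rewrite -phiD subrK add0r phiZ.
Qed.

(** * The generic fibre, and B as a ring without zero divisors *)

Section ZeroIdeal.
Variable R : idomainType.

Definition zero_ideal : R -> bool := pred1 0.

Lemma zero_ideal_closed : idealr_closed zero_ideal.
Proof.
split; rewrite ?/in_mem /=; first exact: eqxx.
  exact: oner_neq0.
move=> a u v; rewrite !/in_mem /= => /eqP -> /eqP ->.
by rewrite mulr0 addr0 /zero_ideal /= eqxx.
Qed.

Lemma zero_ideal_prime : prime_idealr_closed zero_ideal.
Proof. by move=> u v; rewrite !/in_mem /= /zero_ideal /= mulf_eq0. Qed.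

HB.instance Definition _ := isIdealr.Build R zero_ideal zero_ideal_closed.
HB.instance Definition _ := isPrimeIdealrClosed.Build R zero_ideal zero_ideal_prime.

End ZeroIdeal.

(** Multiplication by [s] is injective on R, hence by flatness on M (x) R. It kills x (x) 1, and the
    action map [ev] from M (x) R to M sends x (x) 1 back to [x]. *)
Lemma flat_torsion_free (R : idomainType) (M : lmodType R) (s : R) (x : M) :
  flat M -> s != 0 -> s *: x = 0 -> x = 0.
Proof.
move=> Mflat s0 sx0.
pose h : {linear R^o -> R^o} := GRing.scale s.
have hinj : injective h by move=> a b; apply: mulfI.
have x10 : pure_tensor x (1 : R^o) = 0.
  apply: (Mflat _ _ h hinj); rewrite tensor_map_pure -pure_tensorZ /= sx0.
  by rewrite -[in RHS](pure_tensor0l M (1 : R^o)) tensor_map_pure !pure_tensor0l.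
pose ev (y : M) (r : R^o) := (r : R) *: y.
have evB : balanced ev.
  split=> [y y' r|y r r'|a y r]; rewrite /ev.
  - exact: scalerDr.
  - exact: scalerDl.
  - by rewrite scalerA mulrC.
rewrite -[x]scale1r -[LHS](tensor_lift_pure evB x 1) x10.
by rewrite -(pure_tensor0l M (1 : R^o)) tensor_lift_pure // /ev scaler0.
Qed.

Lemma affine_fibration_mulf_eq0 (R : idomainType) (B : comAlgType R) n (x y : B) :
  affine_fibration n B -> x * y = 0 -> x = 0 \/ y = 0.
Proof.
move=> [_ Bflat /(_ (@zero_ideal R))[f [[g fK gK] fZ]]] xy0.
(* At the zero prime the extended ideal is zero, so an element that dies in the fibre is killed by a
   nonzero scalar. *)
have fib_inj z : f (fibre_in _ z) = 0 -> z = 0.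
  rewrite -(rmorph0 f) => /(can_inj fK)/fibre_in_eq0[s s0 ez].
  apply: (flat_torsion_free Bflat s0); move: (s *: z) ez => w.
  apply: (@ideal_gen_sub _ _ [set 0]).
    by split=> //= [u v -> ->|a u ->]; rewrite ?addr0 ?mulr0.
  by move=> _ [a /eqP -> ->]; rewrite /= scale0r.
have : f (fibre_in _ x) * f (fibre_in _ y) = 0.
  by rewrite -rmorphM -fibre_inM xy0 fibre_in0 rmorph0.
move: (fib_inj x) (fib_inj y).
move: (f (fibre_in _ x)) (f (fibre_in _ y)) => P Q Px Qy PQ.
have [P0|P0] := eqVneq P 0; first by left; exact: Px.
have [Q0|Q0] := eqVneq Q 0; first by right; exact: Qy.
exfalso; move: P0 Q0; rewrite -!mleadc_eq0 => /eqP P0 /eqP Q0.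
(* The product of the leading coefficients is a coefficient of [P * Q], and the coefficients lie in
   a field. *)
have : P@_(mlead P) * Q@_(mlead Q) = 0.
  by rewrite -mleadcM PQ mcoeff0.
by move=> /residue_mulf_eq0[].
Qed.

(** * Derivations, and the ideal D(B)B locally at a prime *)

Lemma subalgebra_mmap (R : comNzRingType) (B : comAlgType R) (A : set B)
    n (b : 'I_n -> B) (q : {mpoly R[n]}) :
  subalgebra A -> (forall i, A (b i)) -> A (mmap (GRing.in_alg B) b q).
Proof.
move=> [Aalg AD AM] Ab; have A0 : A 0 by rewrite -(scale0r 1).
have A1 : A 1 by rewrite -(scale1r 1).
rewrite /mmap; apply: (big_ind A) => // m _; apply: (AM); first exact: Aalg.
rewrite /mmap1; apply: (big_ind A) => // i _.
by elim: (m i) => // e IH; rewrite exprS; exact: AM.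
Qed.

Section Derivation.
Variables (R : comNzRingType) (B : comAlgType R) (D : {linear B -> B}).
Hypothesis DL : derivation D.

Lemma derivation_alg a : D a%:A = 0.
Proof.
rewrite linearZ /=; suff -> : D 1 = 0 by rewrite scaler0.
have := DL 1 1; rewrite !mul1r => e; apply: (addrI (D 1)).
by rewrite -e addr0.
Qed.

(** Scalars have derivative 0 and products follow the Leibniz rule. Thus whether [D] takes values in
    [J] can be tested on algebra generators. *)
Lemma subalgebra_derivation J : is_ideal J -> subalgebra [set x | J (D x)].
Proof.
move=> [J0 JD JM]; split=> /= [a|x y Jx Jy|x y Jx Jy].
- by rewrite derivation_alg.
- by rewrite linearD; exact: JD.
- by rewrite DL; apply: JD; exact: JM.
Qed.

End Derivation.

Lemma derivation_ideal_local2 (R : comNzRingType) (B : comAlgType R)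
    (D : {linear B -> B}) (P : set B) :
  affine_fibration 2 B -> derivation D -> prime_ideal P ->
  exists d x y, ~ P d /\
    forall a, ideal_gen (range D) a -> @ideal_gen B [set` [:: D x; D y]] (d * a).
Proof.
move=> [[m [b bgen]] _ fib] DL Pprime; have [Pid P1 PM] := Pprime.
have [P0 PD PMl] := Pid.
(* [q] is the contraction of [P] to R, packed below as the prime [p] at which the fibre is taken. *)
pose q : R -> bool := fun a => `[< P a%:A >].
have q_ideal : idealr_closed q.
  split; rewrite ?/in_mem /=.
  - by apply/asboolP; rewrite scale0r.
  - by apply/asboolPn; rewrite scale1r.
  - move=> a u v; rewrite !/in_mem /= => /asboolP Pu /asboolP Pv; apply/asboolP.
    by rewrite scalerDl -scalerA -mulr_algl; apply: PD => //; exact: PMl.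
have q_prime : prime_idealr_closed q.
  move=> u v; rewrite !/in_mem /= => /asboolP.
  rewrite -scalerA -mulr_algl => /PM[] ?; apply/orP; [left|right]; exact/asboolP.
pose q1 := isIdealr.Build R q q_ideal.
pose q2 := isPrimeIdealrClosed.Build R q q_prime.
pose p : prime_idealr R := HB.pack q q1 q2.
have pP a : a \in p -> P a%:A by move=> /asboolP.
have npP s : s \notin p -> ~ P s%:A by move=> sp Ps; move/negP: sp; apply; exact/asboolP.
have [f [fbij fZ]] := fib p.
have [x xgen] := fibre_generators fbij fZ.
pose J := @ideal_gen B [set` [:: D (x ord0); D (x ord_max)]].
have Jid : is_ideal J := ideal_gen_ideal _.
(* The derivatives of the algebra generators form a finite generating sequence of D(B)B, to which
   Nakayama's lemma applies; [JP] is then J + P D(B)B. *)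
pose w := [seq D (b i) | i : 'I_m].
pose JP := ideal_add_mul J P w.
have JPid : is_ideal JP := ideal_add_mul_ideal w Jid Pid.
have [JP0 JPD JPM] := JPid.
have bw i : D (b i) \in w by apply/mapP; exists i; rewrite ?mem_enum.
have wgen z : @ideal_gen B [set` w] (D z).
  have [r ->] := bgen z; have := subalgebra_derivation DL (ideal_gen_ideal [set` w]).
  move=> /subalgebra_mmap; apply.
  by move=> i; apply: sub_ideal_gen; exact: bw.
have PI a z : P a -> JP (a * D z).
  move=> Pa; apply: (ideal_gen_sub (ideal_colon a JPid) _ (wgen z)).
  by move=> u uw; exact: ideal_add_mul_mem.
have Dext z : extended_ideal p z -> JP (D z).
  (* The induction is strengthened by [P z]: in D(c u) = c D(u) + u D(c) the second term lies in
     [JP] because [u] lies in [P]. *)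
  suff : extended_ideal p z -> P z /\ JP (D z) by move=> h /h[].
  apply: (@ideal_gen_sub B _ [set y | P y /\ JP (D y)]).
    split=> /= [|u v [Pu Ju] [Pv Jv]|c u [Pu Ju]].
    - by rewrite linear0.
    - by split; [exact: PD|rewrite linearD; exact: JPD].
    - by split; [exact: PMl|rewrite DL; apply: JPD; [exact: JPM|exact: PI]].
  by move=> _ [a /pP Pa ->]; rewrite /= derivation_alg.
have Dloc z : exists2 t, ~ P t & JP (t * D z).
  (* Take for [A] the elements with derivative in [J]. Then D(y) lies in [J] and s' (s z - y) lies
     in pB, so applying [D] puts s' s D(z) in [JP]. *)
  have [|s sp [y Jy [s' sp' ext]]] := xgen _ (subalgebra_derivation DL Jid) _ z.
    move=> i /=; apply: sub_ideal_gen; rewrite /= !inE.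
    case: i => [[|[|//]] i]; apply/orP; [left|right]; apply/eqP; congr (D (x _)); exact: val_inj.
  exists (s' * s)%:A; first by apply: npP; exact: prime_complM.
  have -> : (s' * s)%:A * D z = D (s' *: (s *: z - y)) + s'%:A * D y.
    by rewrite linearZ linearB linearZ /= !mulr_algl scalerBr subrK scalerA.
  by apply: JPD; [exact: Dext|apply: JPM; exact: ideal_add_mul_subl].
have [|d nPd dw] := @local_nakayama B J P w Jid Pprime.
  by move=> _ /mapP[i _ ->]; exact: Dloc.
exists d, (x ord0), (x ord_max); split=> // a.
apply: (ideal_gen_sub (ideal_colon d Jid)) => _ [z _ <-].
exact: (ideal_gen_sub (ideal_colon d Jid) dw (wgen z)).
Qed.

Theorem proposition3p7 (R : idomainType) (B : comAlgType R)
    (D : {linear B -> B}) :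
  noetherian R ->
  contains_rat R ->
  affine_fibration 2 B ->
  derivation D ->
  locally_nilpotent D ->
  (exists b : B, D b <> 0%R) ->
  grade (ideal_gen (range D)) = EFin 1%N \/
  grade (ideal_gen (range D)) = EFin 2%N \/
  grade (ideal_gen (range D)) = +oo%E.
Proof.
move=> _ _ fib DL _ [b Db0].
have Iid := ideal_gen_ideal (range D).
have DI z : ideal_gen (range D) (D z) by apply: sub_ideal_gen; exists z.
have [IT|IT] := pselect (ideal_gen (range D) = setT).
  by right; right; rewrite /grade asboolT.
have [P [Pprime IP]] := exists_prime_ideal Iid ((ideal_proper Iid).1 IT).
have [d [x [y [nPd dI]]]] := derivation_ideal_local2 fib DL Pprime.
have [||e|e] := grade_le2 Iid IT (DI b); [| |by left|by right; left].
  by move=> c /(affine_fibration_mulf_eq0 fib)[].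
move=> s sreg sI.
by apply: (regular_seq_local2 Pprime (IP _ (DI x)) (IP _ (DI y)) nPd sreg) => a /sI/dI.
Qed.
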